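(* Let $\mathcal{T}$ be a tree, $k\in\mathbb{N}$, and let $G$ be a closed subgroup of $\mathrm{Aut}(\mathcal{T})$. Then $G$ satisfies Property $IP_k$ if and only if $G$ satisfies Property $P_k$.
   Context: All trees are locally finite simple graphs; $\mathbb{N}=\{1,2,3,\dots\}$. $\mathrm{Aut}(\mathcal{T})$ carries the topology with basis the sets $\mathscr{U}(x,\mathcal{F})=\{y\in\mathrm{Aut}(\mathcal{T}): y.v=x.v\ \forall v\in\mathcal{F}\}$, $x\in\mathrm{Aut}(\mathcal{T})$, $\mathcal{F}\subseteq V(\mathcal{T})$ finite. $B(v,k)$ is the subtree formed by the closed ball of radius $k$ about the vertex $v$ in the graph metric. For an edge $(v,w)$, the semi-tree $\mathcal{T}_{(v,w)}$ is the connected component containing $w$ of the graph obtained from $\mathcal{T}$ by deleting the edges $(v,w),(w,v)$ (keeping their endpoints). $\mathrm{Fix}_H(Y)$ is the set of $h\in H$ fixing every vertex of $Y$. Property $IP_k$: $G$ satisfies it if for every edge $e=(v,w)$ of $\mathcal{T}$, with $F_{k,e}:=\mathrm{Fix}_G(B(v,k)\cap B(w,k))$, one has $F_{k,e}=\mathrm{Fix}_{F_{k,e}}(\mathcal{T}_{(v,w)})\,\mathrm{Fix}_{F_{k,e}}(\mathcal{T}_{(w,v)})$. Property $P_k$: for a subtree $X$ let $X^r$ be the subtree spanned by the vertices at distance at most $r$ from $X$. For a path $C$ in $\mathcal{T}$ (without backtracking; finite, infinite or doubly-infinite), let $\pi:V(\mathcal{T})\to V(C)$ send each vertex to the closest vertex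 of $C$, and for $x\in V(C)$ let $F_x$ be the permutation group on $\pi^{-1}(x)$ induced by the action of $\mathrm{Fix}_G(C^{k-1})$. $G$ satisfies Property $P_k$ iff for every such $C$ the natural homomorphism $\Phi:\mathrm{Fix}_G(C^{k-1})\to\prod_{x\in V(C)}F_x$ is an isomorphism. *)

(* Defs.v *)
From HB Require Import structures.
From mathcomp Require Import all_boot all_order all_algebra.
From mathcomp Require Import all_classical topology.

Set Implicit Arguments.
Unset Strict Implicit.
Unset Printing Implicit Defensive.

Import Order.TTheory GRing.Theory Num.Theory.
Local Open Scope classical_set_scope.

(* Groups need not be finite here, so subgroups are sets in a [groupType]
   rather than the [{group gT}] of fingroup. *)

Record subgroup (gT : groupType) := Subgroup {
  subgroup_set :> set gT;
  subgroupP : group_closed [pred x | x \in subgroup_set] }.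

Section SubgroupType.
Variables (gT : groupType) (H : subgroup gT).

Definition subg := {x : gT | x \in (H : set gT)}.

HB.instance Definition _ := SubChoice.on subg.
HB.instance Definition _ :=
  SubChoice_isSubGroup.Build gT (fun x => x \in (H : set gT)) subg
    (subgroupP H).

Lemma subgP (x : subg) : (H : set gT) (val x).
Proof. exact: set_mem (valP x). Qed.

Lemma subgroup1 : (H : set gT) 1%g.
Proof. exact: set_mem (proj1 (subgroupP H)). Qed.

Lemma subgroupF x y : (H : set gT) x -> (H : set gT) y ->
  (H : set gT) (x / y)%g.
Proof.
by move=> /mem_set Hx /mem_set Hy; exact/set_mem/(proj2 (subgroupP H)).
Qed.
End SubgroupType.

Lemma group_closed_set (gT : groupType) (A : set gT) :
    A 1%g -> (forall x y, A x -> A y -> A (x / y)%g) ->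
  group_closed [pred x | x \in A].
Proof.
move=> A1 AF; split; first exact: mem_set.
by move=> x y /set_mem Ax /set_mem Ay; exact/mem_set/AF.
Qed.

Section ImageSubgroup.
Variables (gT hT : groupType) (f : gT -> hT).
Hypothesis fM : {morph f : x y / (x * y)%g}.

Lemma image_group_closed : group_closed [pred y | y \in range f].
Proof.
have f1 : f 1%g = 1%g.
  by apply: (@mulIg _ (f 1%g)); rewrite -fM !mul1g.
have fV x : f (x^-1)%g = ((f x)^-1)%g.
  by apply: (@mulIg _ (f x)); rewrite -fM !mulVg.
apply: group_closed_set; first by exists 1%g.
by move=> _ _ [x _ <-] [y _ <-]; exists (x / y)%g => //; rewrite fM fV.
Qed.

Definition image_subgroup := Subgroup image_group_closed.
End ImageSubgroup.

Section ProductGroup.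
Variables (I : Type) (F : I -> groupType).

Definition group_prod := forall i, F i.

HB.instance Definition _ := Choice.on group_prod.

Let prod_mul (x y : group_prod) : group_prod := fun i => (x i * y i)%g.
Let prod_one : group_prod := fun i => 1%g.
Let prod_inv (x : group_prod) : group_prod := fun i => ((x i)^-1)%g.

Let prod_mulA : associative prod_mul.
Proof.
move=> x y z; apply: functional_extensionality_dep => i; exact: mulgA.
Qed.
Let prod_mul1 : left_id prod_one prod_mul.
Proof.
move=> x; apply: functional_extensionality_dep => i; exact: mul1g.
Qed.
Let prod_1mul : right_id prod_one prod_mul.
Proof.
move=> x; apply: functional_extensionality_dep => i; exact: mulg1.
Qed.
Let prod_mulV : left_inverse prod_one prod_inv prod_mul.
Proof.
move=> x; apply: functional_extensionality_dep => i; exact: mulVg.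
Qed.
Let prod_Vmul : right_inverse prod_one prod_inv prod_mul.
Proof.
move=> x; apply: functional_extensionality_dep => i; exact: mulgV.
Qed.

HB.instance Definition _ :=
  isGroup.Build group_prod prod_mulA prod_mul1 prod_1mul prod_mulV prod_Vmul.
End ProductGroup.

Definition group_isomorphism (gT hT : groupType) (f : gT -> hT) :=
  {morph f : x y / (x * y)%g} /\ bijective f.

(* The symmetric group of an arbitrary set, acting on the left:
   [(s * t)%g x = s (t x)]. *)

Record sym (X : Type) := Sym {
  sym_fun :> X -> X;
  sym_inv : X -> X;
  sym_funK : cancel sym_fun sym_inv;
  sym_invK : cancel sym_inv sym_fun }.

Section SymGroup.
Variable X : Type.
Implicit Types s t : sym X.

Lemma sym_eq s t : s =1 t -> s = t.
Proof.
case: s t => [f f' fK f'K] [g g' gK g'K] /= /funext efg.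
rewrite {}efg in fK f'K *.
have e' : f' = g' by apply: funext => x; rewrite -{1}(g'K x) fK.
rewrite {}e' in fK f'K *.
by congr Sym; apply: Prop_irrelevance.
Qed.

HB.instance Definition _ := gen_eqMixin (sym X).
HB.instance Definition _ := gen_choiceMixin (sym X).

Definition sym_one : sym X := @Sym X id id (frefl _) (frefl _).
Definition sym_V s : sym X := Sym (@sym_invK _ s) (@sym_funK _ s).
Definition sym_mul s t : sym X :=
  Sym (can_comp (@sym_funK _ s) (@sym_funK _ t))
      (can_comp (@sym_invK _ t) (@sym_invK _ s)).

Let sym_mulA : associative sym_mul.
Proof. by move=> s t u; exact: sym_eq. Qed.
Let sym_mul1 : left_id sym_one sym_mul.
Proof. by move=> s; exact: sym_eq. Qed.
Let sym_1mul : right_id sym_one sym_mul.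
Proof. by move=> s; exact: sym_eq. Qed.
Let sym_mulV : left_inverse sym_one sym_V sym_mul.
Proof. by move=> s; apply: sym_eq => x; exact: sym_funK. Qed.
Let sym_Vmul : right_inverse sym_one sym_V sym_mul.
Proof. by move=> s; apply: sym_eq => x; exact: sym_invK. Qed.

HB.instance Definition _ :=
  isGroup.Build (sym X) sym_mulA sym_mul1 sym_1mul sym_mulV sym_Vmul.
End SymGroup.

Section SymRestrict.
Variables (X : Type) (A : set X) (s : sym X).
Hypothesis sA : forall x, A (s x) <-> A x.

Let restr_fun (u : A) : A := exist _ (s (val u))
  (mem_set (proj2 (sA (val u)) (set_mem (valP u)))).

Lemma sym_restrict_invP (u : A) : A (sym_inv s (val u)).
Proof. by apply/sA; rewrite sym_invK; exact: set_mem (valP u). Qed.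

Let restr_inv (u : A) : A := exist _ (sym_inv s (val u))
  (mem_set (sym_restrict_invP u)).

Let restr_funK : cancel restr_fun restr_inv.
Proof. by move=> u; apply: val_inj; exact: sym_funK. Qed.
Let restr_invK : cancel restr_inv restr_fun.
Proof. by move=> u; apply: val_inj; exact: sym_invK. Qed.

Definition sym_restrict : sym A := Sym restr_funK restr_invK.
End SymRestrict.

Record tree := Tree {
  vertex :> choiceType;
  adj : rel vertex;
  adj_sym : symmetric adj;
  adj_irr : irreflexive adj;
  tree_locally_finite : forall v, finite_set [set w | adj v w];
  tree_nonempty : inhabited vertex;
  tree_connected : forall u v, exists p, path adj u p /\ last u p = v;
  tree_acyclic : forall c : seq vertex, ucycle adj c -> (size c <= 2)%N }.

Section Tree.
Variable T : tree.
Implicit Types (u v w : T) (X Y : set T).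

Definition walk_len u v (n : nat) : bool :=
  `[< exists p, [/\ size p = n, path (@adj T) u p & last u p = v] >].

Lemma walk_len_ex u v : exists n, walk_len u v n.
Proof.
have [p [pp lp]] := tree_connected u v; exists (size p).
by apply/asboolP; exists p.
Qed.

Definition dist u v : nat := ex_minn (walk_len_ex u v).

Definition ball v (k : nat) : set T := [set u | (dist v u <= k)%N].

(* Subtrees are given by their vertex sets; [nbhd X r] is the paper's X^r. *)
Definition nbhd X (r : nat) : set T :=
  [set u | exists2 x, X x & (dist x u <= r)%N].

Definition del_edge v w : rel T := fun a b =>
  [&& adj a b, (a, b) != (v, w) & (a, b) != (w, v)].

Definition semi_tree v w : set T :=
  [set u | exists p, path (del_edge v w) w p /\ last w p = u].

Lemma Aut_closed : group_closed
  [pred s | s \in [set s : sym T | forall u v, adj (s u) (s v) = adj u v]].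
Proof.
apply: group_closed_set => // s t /= sP tP u v.
by rewrite sP -[in RHS](sym_invK t u) -[in RHS](sym_invK t v) tP.
Qed.

Definition Aut : subgroup (sym T) := Subgroup Aut_closed.

Definition aut := subg Aut.

HB.instance Definition _ := Group.on aut.

Definition aut_sym (g : aut) : sym T := val g.
Coercion aut_sym : aut >-> sym.

Lemma aut_adj (g : aut) u v : adj (g u) (g v) = adj u v.
Proof. exact: (subgP g). Qed.

HB.instance Definition _ := isPointed.Build aut 1%g.

Definition aut_basis (xF : aut * set T) : set aut :=
  [set y | forall v, xF.2 v -> y v = xF.1 v].

Definition aut_basis_dom : set (aut * set T) := [set xF | finite_set xF.2].

Let aut_basis_cover : \bigcup_(xF in aut_basis_dom) aut_basis xF = setT.
Proof.
by apply/seteqP; split => // x _; exists (x, set0) => //; exact: finite_set0.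
Qed.

Let aut_basis_join i j t : aut_basis_dom i -> aut_basis_dom j ->
    aut_basis i t -> aut_basis j t ->
  exists k, [/\ aut_basis_dom k, aut_basis k t &
                aut_basis k `<=` aut_basis i `&` aut_basis j].
Proof.
case: i j => [x E] [y F] /= finE finF tE tF; exists (t, E `|` F).
split => //; first by rewrite /aut_basis_dom /= finite_setU.
by move=> z zP; split=> v vP /=; [rewrite zP ?tE|rewrite zP ?tF] => //;
  [left|right].
Qed.

HB.instance Definition _ :=
  isBaseTopological.Build aut aut_basis_cover aut_basis_join.

Lemma Fix_closed (H : subgroup aut) Y : group_closed
  [pred h | h \in [set h : aut | (H : set aut) h /\ forall y, Y y -> h y = y]].
Proof.
apply: group_closed_set => /=; first by split=> //; exact: subgroup1.
move=> g h [Hg gY] [Hh hY]; split; first exact: subgroupF.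
move=> y Yy; change (g (sym_inv h y) = y).
by rewrite -[X in sym_inv h X](hY y Yy) sym_funK gY.
Qed.

Definition Fix (H : subgroup aut) Y : subgroup aut := Subgroup (Fix_closed H Y).

Definition property_IP (k : nat) (G : subgroup aut) : Prop :=
  forall v w, adj v w ->
    let F := Fix G (ball v k `&` ball w k) in
    (F : set aut) =
      [set (a * b)%g | a in (Fix F (semi_tree v w) : set aut)
                     & b in (Fix F (semi_tree w v) : set aut)].

(* The vertices of a path are indexed by a nonempty interval of integers, which
   may be bounded, or unbounded on one or both sides; the values of [path_pt]
   outside [path_dom] are irrelevant. *)
Record tree_path := TreePath {
  path_dom : interval int;
  path_pt : int -> T;
  path_nonempty : exists i, i \in path_dom;
  path_adj : forall i, i \in path_dom -> (i + 1)%R \in path_dom ->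
    adj (path_pt i) (path_pt (i + 1)%R);
  path_nobacktrack : forall i, i \in path_dom -> (i + 2)%R \in path_dom ->
    path_pt i != path_pt (i + 2)%R }.

Definition path_vertices (C : tree_path) : set T :=
  [set path_pt C i | i in [set i | i \in path_dom C]].

Section PropertyP.
Variables (k : nat) (G : subgroup aut) (C : tree_path).

Definition closest u : set T :=
  [set x | path_vertices C x /\
           forall y, path_vertices C y -> (dist u x <= dist u y)%N].

Definition proj u : T := xget u (closest u).

Definition fiber (x : T) : set T := [set u | proj u = x].

Definition FixC : subgroup aut := Fix G (nbhd (path_vertices C) (k - 1)).

Lemma walk_len_aut (g : aut) u v n : walk_len (g u) (g v) n = walk_len u v n.
Proof.
have walkS (h : aut) a b : walk_len a b n -> walk_len (h a) (h b) n.
  move=> /asboolP[p [sp pp <-]]; apply/asboolP; exists (map h p).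
  rewrite size_map last_map path_map; split => //.
  by rewrite (eq_path (e' := @adj T)) // => c d; rewrite /= aut_adj.
apply/idP/idP; last exact: walkS.
pose h : aut := (g^-1)%g; have gK a : h (g a) = a by exact: sym_funK.
by move=> /(walkS h); rewrite !gK.
Qed.

Lemma dist_aut (g : aut) u v : dist (g u) (g v) = dist u v.
Proof.
rewrite /dist; case: ex_minnP => m mP mmin; case: ex_minnP => n nP nmin.
rewrite walk_len_aut in mP; apply/eqP; rewrite eqn_leq nmin // mmin //.
by rewrite walk_len_aut.
Qed.

Lemma dist_refl u : dist u u = 0%N.
Proof.
rewrite /dist; case: ex_minnP => m _ /(_ 0%N) m0; apply/eqP.
by rewrite -leqn0 m0 //; apply/asboolP; exists [::].
Qed.

Lemma FixC_path (g : subg FixC) x : path_vertices C x -> (val g : aut) x = x.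
Proof.
by move=> Cx; have [_] := subgP g; apply; exists x => //; rewrite dist_refl.
Qed.

Lemma path_closest u : exists x, closest u x.
Proof.
have [i iC] := path_nonempty C.
pose P n := `[< exists2 x, path_vertices C x & dist u x = n >].
have exP : exists n, P n.
  exists (dist u (path_pt C i)); apply/asboolP.
  by exists (path_pt C i) => //; exists i.
case: (ex_minnP exP) => _ /asboolP[x Cx <-] xmin; exists x; split=> // y Cy.
by apply: xmin; apply/asboolP; exists y.
Qed.

Lemma proj_FixC (g : subg FixC) u : proj ((val g : aut) u) = proj u.
Proof.
have -> : proj ((val g : aut) u) = xget u (closest ((val g : aut) u)).
  rewrite /proj; have [x xP] := path_closest ((val g : aut) u).
  by rewrite /xget; case: pselect => // -[]; exists x; apply/asboolP.
have dgP x : path_vertices C x -> dist ((val g : aut) u) x = dist u x.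
  by move=> Cx; rewrite -{1}(FixC_path g Cx) dist_aut.
rewrite /proj; congr xget; apply/seteqP; split=> x [Cx xmin];
  split=> // y Cy; have := xmin y Cy; by rewrite !dgP.
Qed.

Lemma FixC_fiber (g : subg FixC) (x : T) u :
  fiber x ((val g : aut) u) <-> fiber x u.
Proof. by rewrite /fiber /= proj_FixC. Qed.

Definition fiber_act (x : T) (g : subg FixC) : sym (fiber x) :=
  sym_restrict (FixC_fiber g x).

Lemma fiber_actM x : {morph fiber_act x : g h / (g * h)%g}.
Proof. by move=> g h; apply: sym_eq => u; exact: val_inj. Qed.

Definition F_ (x : T) : subgroup (sym (fiber x)) :=
  image_subgroup (fiber_actM x).

Lemma fiber_act_F x g : fiber_act x g \in (F_ x : set (sym (fiber x))).
Proof. by rewrite inE; exists g. Qed.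

Definition Phi (g : subg FixC) :
    group_prod (fun x : path_vertices C => subg (F_ (val x)) : groupType) :=
  fun x => exist _ (fiber_act (val x) g) (fiber_act_F (val x) g).

End PropertyP.

Definition property_P (k : nat) (G : subgroup aut) : Prop :=
  forall C : tree_path, group_isomorphism (@Phi k G C).

End Tree.

(* Main.v *)
(* In a tree, two distinct neighbours of [p] cannot both be at least as close
   to [u] as [p] is; hence the semi-trees of an edge, the intersection of the
   two balls about its ends and the fibres of the projection onto a path are all
   described by comparing distances.

   P_k => IP_k: apply P_k to the path consisting of the edge, whose fibres are
   the two semi-trees.

   IP_k => P_k: if [f] fixes C^(k-1), then IP_k at the edge (C_i, C_(i+1)) gives
   [a_i] agreeing with [f] on the fibres of the C_j with j <= i and trivial on
   the other fibres. So [a_i / a_(i-1)] is [f] on the fibre of C_i and trivial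
   elsewhere. Finite products of such elements realise any family of elements of
   the F_x on finitely many fibres, and since [G] is closed, on all of them. *)

From Pilot Require Import Defs.
From mathcomp Require Import all_boot all_order all_algebra.
From mathcomp Require Import all_classical topology.
From mathcomp Require Import zify.

Set Implicit Arguments.
Unset Strict Implicit.
Unset Printing Implicit Defensive.

Import Order.TTheory GRing.Theory Num.Theory.
(* Takes [proj] and [ball] back from the homonyms of [topology]. *)
Import Pilot.Defs.
Local Open Scope classical_set_scope.

(** * Distances and semi-trees in a tree *)

Section Distance.
Variable T : tree.
Implicit Types (u v w p a b : T).

Lemma dist_path_le u (s : seq T) :
  path (@adj T) u s -> (dist u (last u s) <= size s)%N.
Proof.
move=> us; rewrite /dist; case: ex_minnP => m _; apply.
by apply/asboolP; exists s.
Qed.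

Lemma dist_geodesic u v :
  exists s, [/\ size s = dist u v, path (@adj T) u s & last u s = v].
Proof. by rewrite /dist; case: ex_minnP => m /asboolP. Qed.

Lemma dist_sym u v : dist u v = dist v u.
Proof.
suff H a b : (dist a b <= dist b a)%N by apply/eqP; rewrite eqn_leq !H.
have [s [<- bs la]] := dist_geodesic b a.
have as' : path (@adj T) a (rev (belast b s)).
  by rewrite -la rev_path (eq_path (e' := @adj T)) // => x y; rewrite adj_sym.
have := dist_path_le as'; rewrite size_rev size_belast.
suff -> : last a (rev (belast b s)) = b by [].
by move: la; case: s {bs as'} => //= x s _; rewrite rev_cons last_rcons.
Qed.

Lemma dist_adj_le u v w : adj v w -> (dist u w <= (dist u v).+1)%N.
Proof.
move=> vw; have [s [<- us lv]] := dist_geodesic u v.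
have := @dist_path_le u (rcons s w).
by rewrite rcons_path us lv vw last_rcons size_rcons; apply.
Qed.

Lemma dist_eq0 u v : dist u v = 0%N -> u = v.
Proof. by have [s [<- _ <-]] := dist_geodesic u v; move/size0nil=> ->. Qed.

Lemma dist_closer_nbr u v : u != v ->
  exists2 w, adj u w & dist u v = (dist w v).+1.
Proof.
have [[|w s] [sz /= us ls]] := dist_geodesic u v; first by rewrite -ls eqxx.
case/andP: us => uw ws _; exists w => //; apply/eqP; rewrite eqn_leq.
apply/andP; split; first by rewrite !(dist_sym _ v) dist_adj_le // adj_sym.
by rewrite -sz ltnS -ls dist_path_le.
Qed.

(** If a geodesic from [a] met [p], its tail would make [p] strictly closer to [u] than [a]. *)
Lemma geodesic_avoids u a p : a != p -> (dist a u <= dist p u)%N ->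
  exists s, [/\ path (@adj T) a s, last a s = u & p \notin s].
Proof.
move=> ap le_ap; have [s [sz as' ls]] := dist_geodesic a u; exists s.
split=> //; apply/negP => ps; case/splitPr: ps sz as' ls => s1 s2.
rewrite size_cat cat_path last_cat /= => sz /and3P[_ _ ps2] ls.
by have := dist_path_le ps2; rewrite ls; lia.
Qed.

Lemma walk_rev u v (P : pred T) :
  (exists s, [/\ path (@adj T) u s, last u s = v & all P (u :: s)]) ->
  exists s, [/\ path (@adj T) v s, last v s = u & all P (v :: s)].
Proof.
case=> s [us <- /= /andP[Pu Ps]]; exists (rev (belast u s)); split.
- by rewrite rev_path (eq_path (e' := @adj T)) // => x y; rewrite adj_sym.
- by case: s {us Ps} => //= x s; rewrite rev_cons last_rcons.
- have: all P (u :: s) by rewrite /= Pu.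
  by rewrite lastI all_rcons /= all_rev.
Qed.

(* Otherwise the geodesics from [a] and [b] to [u], both avoiding [p], close up
   to a cycle through [p]. *)
Lemma closer_nbr_unique u p a b : adj p a -> adj p b ->
  (dist a u <= dist p u)%N -> (dist b u <= dist p u)%N -> a = b.
Proof.
move=> pa pb da db; apply/eqP/negP => /negP nab.
have nap : a != p by apply/eqP => e; move: pa; rewrite e adj_irr.
have nbp : b != p by apply/eqP => e; move: pb; rewrite e adj_irr.
have [s [as' ls ps]] := geodesic_avoids nap da.
have [t [ut lt pt]] : exists s, [/\ path (@adj T) u s, last u s = b
     & all (predC1 p) (u :: s)].
  apply: walk_rev; have [t [bt lt pt]] := geodesic_avoids nbp db; exists t.
  split=> //=; rewrite nbp /=.
  by apply/allP => x xt /=; apply: contraNneq pt => <-.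
have ast : path (@adj T) a (s ++ t) by rewrite cat_path as' ls.
have lst : last a (s ++ t) = b by rewrite last_cat ls.
have : p \notin a :: s ++ t.
  rewrite inE mem_cat !negb_or eq_sym nap ps /=.
  apply/negP => tp; have := allP pt p; rewrite inE tp orbT /= eqxx.
  by move=> /(_ isT).
move: lst; case/shortenP: ast => r ar ur sub lr.
rewrite inE negb_or => /andP[npa npst].
have pr : p \notin r by apply: contra npst => /sub.
have: ucycle (@adj T) (p :: a :: r).
  rewrite /ucycle /= rcons_path pa ar lr adj_sym pb /= inE negb_or npa pr.
  by move: ur => /= ->.
move=> /tree_acyclic; case: r lr {ar ur sub pr} => //= e.
by move: nab; rewrite e eqxx.
Qed.

(** For [v != u], a tie would force the neighbour of [v] closer to [u] to be [w]. *)
Lemma dist_adj_neq u v w : adj v w -> dist u v != dist u w.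
Proof.
move=> vw; apply/eqP; rewrite (dist_sym u v) (dist_sym u w) => e.
have [vu|vu] := eqVneq v u.
  move: e vw; rewrite vu dist_refl => /esym/dist_eq0 ->.
  by rewrite adj_irr.
have [x vx ex] := dist_closer_nbr vu.
have xw : x = w by apply: (closer_nbr_unique (u := u) vx vw); lia.
by move: ex; rewrite xw e; lia.
Qed.

Lemma dist_adj_cases u v w : adj v w ->
  dist u v = (dist u w).+1 \/ dist u w = (dist u v).+1.
Proof.
move=> vw; have := dist_adj_neq u vw; have := dist_adj_le u vw.
by rewrite adj_sym in vw; have := dist_adj_le u vw; lia.
Qed.

(** A walk that does not use the edge never changes its nearer end; conversely, a geodesic from [w]
    to a vertex nearer to [w] misses [v]. *)
Lemma semi_treeP v w u : adj v w ->
  semi_tree v w u <-> (dist u w < dist u v)%N.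
Proof.
move=> vw; split=> [[s [ws <-]]|lt_wv].
  elim/last_ind: s ws => [_|s b IHs].
    by rewrite /= dist_refl; have := dist_adj_neq w vw; rewrite dist_refl; lia.
  rewrite rcons_path last_rcons => /andP[/IHs]; set a := last w s => lt_a.
  case/and3P => ab _ nab; rewrite ltnNge leq_eqVlt negb_or dist_adj_neq //=.
  apply/negP => lt_b; have := dist_adj_cases a vw; have := dist_adj_cases b vw.
  have := dist_adj_cases v ab; have := dist_adj_cases w ab.
  rewrite !(dist_sym v) !(dist_sym w) => h1 h2 h3 h4.
  (* The step from [a] to [b] changes side; distances vary by exactly one along an edge, which
     forces these values. *)
  have {h1 h2 h3 h4} [e1 e2 e3] : [/\ dist a w = dist b v,
    dist a v = (dist b v).+1 & dist b w = (dist b v).+1] by split; lia.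
  have [aw|aw] := eqVneq a w.
    by move: e1 nab; rewrite aw dist_refl => /esym/dist_eq0 ->; rewrite eqxx.
  have [x ax ex] := dist_closer_nbr aw.
  (* Both are neighbours of [a] no farther from [v] than [a], yet [x] is closer to [w] and [b] is
     not. *)
  have xb : x = b.
    apply: (closer_nbr_unique (u := v) ax ab); last by lia.
    by have := dist_adj_cases x vw; lia.
  by move: ex; rewrite xb; lia.
have [s [sz ws ls]] := dist_geodesic w u; exists s; split=> //.
have vs : v \notin s.
  apply/negP => vs; case/splitPr: vs sz ws ls => s1 s2.
  rewrite size_cat cat_path last_cat /= => sz /and3P[_ _ vs2] ls.
  have := dist_path_le vs2; rewrite ls (dist_sym v).
  by rewrite (dist_sym w) in sz; lia.
have: v \notin w :: s.
  rewrite inE negb_or vs andbT; apply: contraTneq vw => ->.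
  by rewrite adj_irr.
(* The start of the walk is generalised, but not the [w] of the deleted edge. *)
elim: s {-3}w ws {sz ls vs} => //= y r IHr x /andP[xy yr].
rewrite inE negb_or => /andP[vx vyr].
rewrite IHr // andbT /del_edge xy !xpair_eqE.
rewrite [x == v]eq_sym (negPf vx) /=; move: vyr; rewrite inE negb_or eq_sym.
by case/andP => /negPf ->; rewrite andbF.
Qed.
End Distance.

(** * Auxiliary facts on intervals and subgroups *)

Lemma interval_convex d (A : porderType d) (I : interval A) (a b c : A) :
  a \in I -> c \in I -> (a <= b)%O -> (b <= c)%O -> b \in I.
Proof.
case: I => l r; rewrite !itv_boundlr => /andP[la _] /andP[_ cr] ab bc.
by rewrite (le_trans la) ?(le_trans _ cr) // bnd_simp.
Qed.

Lemma subgroupV (gT : groupType) (H : subgroup gT) x :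
  (H : set gT) x -> (H : set gT) (x^-1)%g.
Proof.
move=> Hx; rewrite -(mul1g x^-1)%g.
by apply: subgroupF => //; exact: subgroup1.
Qed.

Lemma subgroupM (gT : groupType) (H : subgroup gT) x y :
  (H : set gT) x -> (H : set gT) y -> (H : set gT) (x * y)%g.
Proof.
by move=> Hx /subgroupV Hy; rewrite -(invgK y); exact: subgroupF.
Qed.

(** * Projection onto a path *)

Section Path.
Variables (T : tree) (C : tree_path T).
Implicit Types (u v w : T) (i j : int).

(** A step that stops receding from [u] would return to the preceding vertex, by
    [closer_nbr_unique]. *)
Lemma dist_ascend u (p : nat -> T) n :
  (forall m, (m <= n)%N -> adj (p m) (p m.+1)) ->
  (forall m, (m < n)%N -> p m != p m.+2) ->
  (dist u (p 0%N) < dist u (p 1%N))%N -> (dist u (p 0%N) < dist u (p n.+1))%N.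
Proof.
move=> padj pnb p01.
suff H m : (m <= n)%N -> (dist u (p 0%N) <= dist u (p m) < dist u (p m.+1))%N.
  by case/andP: (H n (leqnn n)) => a b; exact: leq_ltn_trans a b.
elim: m => [_|m IHm lt_mn]; first by rewrite leqnn.
have /andP[le_m lt_m] := IHm (ltnW lt_mn).
apply/andP; split; first by lia.
rewrite ltnNge; apply/negP => le.
have /eqP[] := pnb m lt_mn; apply: (@closer_nbr_unique _ u (p m.+1)).
- by rewrite adj_sym padj // ltnW.
- exact: padj.
- by rewrite !(dist_sym _ u) ltnW.
- by rewrite !(dist_sym _ u).
Qed.

Lemma projP u : closest C u (proj C u).
Proof. exact: xgetPex _ (path_closest C u). Qed.

Lemma proj_index u : exists2 i, i \in path_dom C & proj C u = path_pt C i.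
Proof. by have [[i iC <-] _] := projP u; exists i. Qed.

(** Otherwise the distance to [u] would grow across the edge and on along [C] up to [C_j], which is
    closest to [u]. *)
Lemma proj_side i j u : i \in path_dom C -> (i + 1)%R \in path_dom C ->
    j \in path_dom C -> proj C u = path_pt C j ->
  if (j <= i)%R then (dist u (path_pt C i) < dist u (path_pt C (i + 1)%R))%N
  else (dist u (path_pt C (i + 1)%R) < dist u (path_pt C i))%N.
Proof.
move=> iC i1C jC uj; have [_ umin] := projP u; rewrite uj in umin.
have minC a : a \in path_dom C ->
    (dist u (path_pt C j) <= dist u (path_pt C a))%N.
  by move=> aC; apply: umin; exists a.
have mem a b c : a \in path_dom C -> b \in path_dom C ->
  (a <= c)%R -> (c <= b)%R -> c \in path_dom C by exact: interval_convex.
have neq_d := dist_adj_neq u (path_adj iC i1C).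
case: ifPn => ji; rewrite ltn_neqAle ?neq_d 1?eq_sym ?neq_d leqNgt /=;
  apply/negP => lt.
- have [n en] : exists n : nat, i = (j + n%:Z)%R by exists `|i - j|%N; lia.
  (* Runs down [C] from index [i + 1] to [j], crossing the edge first. *)
  pose p m := path_pt C (i + 1 - m%:Z)%R.
  have ep0 : p 0%N = path_pt C (i + 1)%R by congr path_pt; lia.
  have ep1 : p 1%N = path_pt C i by congr path_pt; lia.
  have epn : p n.+1 = path_pt C j by congr path_pt; lia.
  suff: (dist u (p 0%N) < dist u (p n.+1))%N.
    by rewrite ep0 epn ltnNge minC.
  apply: dist_ascend => [m mn|m mn|]; last by rewrite ep0 ep1.
  + rewrite adj_sym /p.
    have -> : (i + 1 - m%:Z = (i + 1 - m.+1%:Z) + 1)%R by lia.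
    by apply: path_adj; apply: (mem j (i + 1)%R) => //; lia.
  + rewrite eq_sym /p.
    have -> : (i + 1 - m%:Z = (i + 1 - m.+2%:Z) + 2)%R by lia.
    by apply: path_nobacktrack; apply: (mem j (i + 1)%R) => //; lia.
- have [n en] : exists n : nat, j = (i + 1 + n%:Z)%R.
    by exists (absz (j - i - 1)%R); lia.
  (* Runs up [C] from index [i] to [j]. *)
  pose p m := path_pt C (i + m%:Z)%R.
  have ep0 : p 0%N = path_pt C i by congr path_pt; lia.
  have epn : p n.+1 = path_pt C j by congr path_pt; lia.
  suff: (dist u (p 0%N) < dist u (p n.+1))%N.
    by rewrite ep0 epn ltnNge minC.
  apply: dist_ascend => [m mn|m mn|]; last by rewrite ep0.
  + rewrite /p; have -> : (i + m.+1%:Z = (i + m%:Z) + 1)%R by lia.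
    by apply: path_adj; apply: (mem i j) => //; lia.
  + rewrite /p; have -> : (i + m.+2%:Z = (i + m%:Z) + 2)%R by lia.
    by apply: path_nobacktrack; apply: (mem i j) => //; lia.
Qed.
End Path.

(** * Reduction of the bijectivity of [Phi] to surjectivity *)

Section Phi.
Variables (T : tree) (k : nat) (G : subgroup (aut T)) (C : tree_path T).

Definition path_proj (u : T) : path_vertices C :=
  exist _ (proj C u) (mem_set (projP C u).1).

Definition in_fiber (u : T) : fiber C (proj C u) :=
  exist _ u (mem_set (erefl : fiber C (proj C u) u)).

Lemma Phi_val (g : subg (FixC k G C)) u :
  (val g : aut T) u = val (val (Phi g (path_proj u)) (in_fiber u)).
Proof. by []. Qed.

(** The fibres cover the tree, so [Phi g] determines [g] and a section of [Phi] is its inverse. *)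
Lemma Phi_bij : (forall t, exists g, @Phi T k G C g = t) ->
  bijective (@Phi T k G C).
Proof.
move=> /choice[Psi PhiK]; exists Psi => // g.
apply: val_inj; apply: val_inj; apply: sym_eq => u.
change ((val (Psi (Phi g)) : aut T) u = (val g : aut T) u).
by rewrite !Phi_val PhiK.
Qed.
End Phi.

(** * From $IP_k$ to $P_k$ *)

Section Cut.
Variables (T : tree) (k : nat) (G : subgroup (aut T)).
Hypotheses (k_gt0 : (0 < k)%N) (GP : property_IP k G).
Implicit Types (u v w x : T) (f a b g h : aut T).

(** The distances from [u] to the two ends differ, so they cannot both be [k]. *)
Lemma ball_edge v w u : adj v w -> ball v k u -> ball w k u ->
  (dist v u <= k - 1)%N \/ (dist w u <= k - 1)%N.
Proof.
rewrite /ball /= => vw; have := dist_adj_neq u vw.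
by rewrite !(dist_sym u); lia.
Qed.

(** Take for [a] the factor fixing the side of [w]; on the side of [v] the other factor is
    trivial. *)
Lemma IP_edge v w f : adj v w -> (G : set (aut T)) f ->
    (forall u, ball v k u -> ball w k u -> f u = u) ->
  exists a, [/\ (G : set (aut T)) a,
    forall u, (dist u v < dist u w)%N -> a u = f u
  & forall u, (dist u w < dist u v)%N -> a u = u].
Proof.
move=> vw Gf fP.
have : (Fix G (ball v k `&` ball w k) : set (aut T)) f.
  by split=> // u [vu wu]; exact: fP.
rewrite (GP vw) => -[a [[Ga _] aP] [b [_ bP] <-]]; exists a; split=> // u lt.
  change (a u = a (b u)); rewrite bP //.
  by apply/semi_treeP; rewrite // adj_sym.
by apply: aP; apply/semi_treeP.
Qed.

Section Fibers.
Variable C : tree_path T.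
Let FC : set (aut T) := FixC k G C.

Lemma proj_Fix g u : FC g -> proj C (g u) = proj C u.
Proof.
by move=> Fg; exact: (proj_FixC (exist _ g (mem_set Fg) : subg (FixC k G C))).
Qed.

(** The disjunction also covers cuts just beyond an end of [C], where [a] is [1] or [f]. *)
Lemma IP_cut i f : i \in path_dom C \/ (i + 1)%R \in path_dom C -> FC f ->
  exists2 a, FC a & forall j u, j \in path_dom C -> proj C u = path_pt C j ->
    a u = if (j <= i)%R then f u else u.
Proof.
move=> iC Ff.
have [iP|iP] := boolP (i \in path_dom C); last first.
  have {}iC : (i + 1)%R \in path_dom C by case: iC => // h; rewrite h in iP.
  exists 1%g; first exact: subgroup1.
  move=> j u jC _; case: ifP => // ji; case/negP: iP.
  by apply: (interval_convex jC iC) => //; lia.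
have [i1P|i1P] := boolP ((i + 1)%R \in path_dom C); last first.
  exists f => // j u jC _; case: ifP => // ji; case/negP: i1P.
  by apply: (interval_convex iP jC) => //; lia.
have [Gf fP] := Ff; have vw := path_adj iP i1P.
have [u vu wu|a [Ga av aw]] := IP_edge vw Gf.
  apply: fP; case: (ball_edge vw vu wu) => le.
    by exists (path_pt C i) => //; exists i.
  by exists (path_pt C (i + 1)%R) => //; exists (i + 1)%R.
have aP j u : j \in path_dom C -> proj C u = path_pt C j ->
    a u = if (j <= i)%R then f u else u.
  move=> jC uj; have := proj_side iP i1P jC uj.
    by case: ifP => _; [exact: av|exact: aw].
(* On [C^(k-1)] each vertex is sent by [a] where [f] or the identity sends it, hence is fixed. *)
exists a => //; split=> // y Yy.
have [j jC yj] := proj_index C y.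
by rewrite (aP j) //; case: ifP => // _; exact: fP.
Qed.

Lemma IP_fiber x f : path_vertices C x -> FC f ->
  exists2 h, FC h & forall u, h u = if proj C u == x then f u else u.
Proof.
move=> [i iC <-] Ff.
have [a Fa aP] := IP_cut (or_introl iC) Ff.
(* Index [i - 1] may fall outside the domain, but its successor [i] does not. *)
have [b Fb bP] : exists2 b, FC b & forall j u, j \in path_dom C ->
    proj C u = path_pt C j -> b u = if (j <= i - 1)%R then f u else u.
  by apply: IP_cut => //; right; rewrite subrK.
exists (a / b)%g; first exact: subgroupF.
move=> u; change (a (sym_inv b u) = if proj C u == path_pt C i then f u else u).
set u' := sym_inv b u; have bu' : b u' = u by exact: sym_invK.
have pu' : proj C u' = proj C u by rewrite -bu' proj_Fix.
have bE j : j \in path_dom C -> proj C u = path_pt C j ->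
    u = if (j <= i - 1)%R then f u' else u'.
  by move=> jC uj; rewrite -{1}bu' (bP j) // pu'.
case: eqP => [ui|ui].
  have := bE i iC ui; case: ifP => [|_ ->]; first by lia.
  by rewrite (aP i) ?pu' // lexx.
have [j jC uj] := proj_index C u.
have nij : j != i by apply/eqP => eij; apply: ui; rewrite uj eij.
rewrite (aP j) ?pu' // [RHS](bE j) //.
(* As [j] differs from [i], the two cuts act alike on this fibre and cancel. *)
have -> : (j <= i - 1)%R = (j <= i)%R by lia.
by [].
Qed.

(** Induction on the list, skipping repetitions and vertices off [C]. *)
Lemma IP_fibers (g : T -> aut T) (s : seq T) : (forall x, FC (g x)) ->
  exists2 h, FC h &
    forall u, h u = if proj C u \in s then g (proj C u) u else u.
Proof.
move=> Fg; elim: s => [|x s [h Fh hP]].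
  by exists 1%g => //; exact: subgroup1.
have [xs|xs] := boolP (x \in s).
  exists h => // u; rewrite hP inE; case: eqP => // ->.
  by rewrite xs.
have [xC|xC] := pselect (path_vertices C x); last first.
  exists h => // u; rewrite hP inE; case: eqP => // ux.
  by case: xC; rewrite -ux; have [] := projP C u.
have [a Fa aP] := IP_fiber xC (Fg x).
(* [h] preserves fibres and is trivial on that of [x], so the product is [a] there and [h]
   elsewhere. *)
exists (a * h)%g; first exact: subgroupM.
move=> u; change (a (h u) =
  if proj C u \in x :: s then g (proj C u) u else u).
rewrite aP proj_Fix // hP inE; case: eqP => //= ->.
by rewrite (negPf xs).
Qed.
End Fibers.

(** A basic neighbourhood constrains finitely many vertices, so [g] lies in the closure of [H]. *)
Lemma closed_finite_approx (H : set (aut T)) g : closed H ->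
  (forall s : seq T, exists2 h, H h & forall u, u \in s -> h u = g u) -> H g.
Proof.
move=> Hcl Hg; apply: Hcl => B; rewrite nbhsE => -[U [Uo Ug] UB].
case: Uo Ug UB => D Dsub <- -[[x F] DxF gxF] UB.
have /finite_seqP[s sF] : finite_set F := Dsub _ DxF.
have [h Hh hP] := Hg s; exists h; split=> //; apply: UB; exists (x, F) => //.
by move=> v /= Fv; rewrite hP; [exact: gxF|move: Fv; rewrite sF].
Qed.

(** * Gluing over all fibres *)

Hypothesis G_closed : closed (subgroup_set G).

Lemma IP_glue (C : tree_path T) (g : T -> aut T) :
    (forall x, (FixC k G C : set (aut T)) (g x)) ->
  exists2 h, (FixC k G C : set (aut T)) h &
    forall u, h u = g (proj C u) u.
Proof.
move=> Fg.
have projV x u : proj C (sym_inv (g x) u) = proj C u.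
  by rewrite -{2}(sym_invK (g x) u) (proj_Fix _ (Fg x)).
(* Each [g x] preserves fibres, so the glued map is inverted fibre by fibre. *)
pose f u := g (proj C u) u; pose f' u := sym_inv (g (proj C u)) u.
have fK : cancel f f'.
  by move=> u; rewrite /f' /f (proj_Fix _ (Fg _)) sym_funK.
have f'K : cancel f' f by move=> u; rewrite /f' /f projV sym_invK.
have approx (s : seq T) : exists2 h, (FixC k G C : set (aut T)) h &
    forall u, u \in s -> h u = f u.
  have [h Fh hP] := IP_fibers [seq proj C u | u <- s] Fg; exists h => // u us.
  by rewrite hP map_f.
(* Preserving adjacency concerns two vertices at a time, where some automorphism agrees with [f]. *)
have fA : (Aut T : set (sym T)) (Sym fK f'K).
  move=> u v; have [h _ hP] := approx [:: u; v].
  by rewrite /= -!hP ?aut_adj // !inE eqxx ?orbT.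
pose a : aut T := exist _ (Sym fK f'K) (mem_set fA).
exists a => //; split.
  apply: closed_finite_approx => // s; have [h [Gh _] hP] := approx s.
  by exists h.
by move=> y Yy; have [_] := Fg (proj C y); apply.
Qed.

Lemma IP_property_P : property_P k G.
Proof.
move=> C; split.
  move=> g h; apply: functional_extensionality_dep => x; apply: val_inj.
  exact: fiber_actM.
apply: Phi_bij => t.
have /choice[y yP] (x : path_vertices C) :
    exists g : subg (FixC k G C), fiber_act (val x) g = val (t x).
  by have [g _ <-] := subgP (t x); exists g.
(* The default [1] keeps every [g x] in [FixC]; projections always lie on [C]. *)
pose g x : aut T := if pselect (path_vertices C x) is left xC
  then val (y (exist _ x (mem_set xC))) else 1%g.
have [x|h Fh hP] := @IP_glue C g.
  rewrite /g; case: pselect => [xC|_]; last exact: subgroup1.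
  exact: subgP.
exists (exist _ h (mem_set Fh)); apply: functional_extensionality_dep => x.
apply: val_inj; apply: sym_eq => u; apply: val_inj; rewrite -yP.
change (h (val u) = (val (y x) : aut T) (val u)).
rewrite hP; have -> : proj C (val u) = val x := set_mem (valP u).
rewrite /g; case: pselect => [xC|[]]; last exact: set_mem (valP x).
by congr ((val (y _) : aut T) _); exact: val_inj.
Qed.
End Cut.

(** * An edge as a path, and from $P_k$ to $IP_k$ *)

Section EdgePath.
Variables (T : tree) (v w : T).
Hypothesis vw : adj v w.

Let edge_pt (i : int) : T := if i == 0%R then v else w.

Let edge_adj i : i \in `[0, 1]%R -> (i + 1)%R \in `[0, 1]%R ->
  adj (edge_pt i) (edge_pt (i + 1)%R).
Proof.
rewrite !in_itv /= => i0 i1; have -> : i = 0%R by lia.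
by rewrite /edge_pt add0r eqxx.
Qed.

Let edge_nobacktrack i : i \in `[0, 1]%R -> (i + 2)%R \in `[0, 1]%R ->
  edge_pt i != edge_pt (i + 2)%R.
Proof. by rewrite !in_itv /= => i0 i2; exfalso; lia. Qed.

Let edge_nonempty : exists i : int, i \in `[0, 1]%R.
Proof. by exists 0%R; rewrite in_itv. Qed.

Definition edge_path := TreePath edge_nonempty edge_adj edge_nobacktrack.

Lemma edge_path_vertices x : path_vertices edge_path x <-> x = v \/ x = w.
Proof.
split=> [[i _ <-]|[->|->]].
- by rewrite /= /edge_pt; case: ifP; [left|right].
- by exists 0%R => //=; rewrite in_itv.
- by exists 1%R => //=; rewrite in_itv.
Qed.

Lemma proj_edge u :
  proj edge_path u = if (dist u v < dist u w)%N then v else w.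
Proof.
have [/edge_path_vertices pu pmin] := projP edge_path u.
have := pmin v (proj2 (edge_path_vertices v) (or_introl erefl)).
have := pmin w (proj2 (edge_path_vertices w) (or_intror erefl)).
have := dist_adj_neq u vw.
by case: pu => ->; case: ltnP => //; lia.
Qed.
End EdgePath.

Lemma P_property_IP (T : tree) (k : nat) (G : subgroup (aut T)) : (0 < k)%N ->
  property_P k G -> property_IP k G.
Proof.
move=> k_gt0 GP v w vw; apply/seteqP; split; last first.
  by move=> _ [a [Fa _] [b [Fb _] <-]]; exact: subgroupM.
move=> f [Gf fP]; pose C := edge_path vw.
(* The vertices within [k - 1] of an end of the edge are those within [k] of both ends. *)
have FixCP g : (FixC k G C : set (aut T)) g <->
    (Fix G (ball v k `&` ball w k) : set (aut T)) g.
  split=> -[Gg gP]; split=> // u.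
    case=> vu wu; apply: gP; case: (ball_edge k_gt0 vw vu wu) => le.
      by exists v => //; apply/edge_path_vertices; left.
    by exists w => //; apply/edge_path_vertices; right.
  case=> x /edge_path_vertices xvw le; apply: gP; move: le.
  have := dist_adj_cases u vw; rewrite /ball /= !(dist_sym _ u).
  by case: xvw => ->; split; lia.
have Ff : (FixC k G C : set (aut T)) f by apply/FixCP.
pose ff : subg (FixC k G C) := exist _ f (mem_set Ff).
have [_ [Psi _ PhiK]] := GP C.
(* Surjectivity of [Phi] yields an element equal to [f] on the fibre of [v] and trivial on that of
   [w]. *)
pose a := Psi (fun x => if val x == v then Phi ff x else 1%g).
have aP u : (val a : aut T) u = if (dist u v < dist u w)%N then f u else u.
  have pE : (val (path_proj C u) == v) = (dist u v < dist u w)%N.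
    rewrite /= proj_edge; case: ltnP => _; first exact: eqxx.
    by apply/negP => /eqP wv; move: (vw); rewrite wv adj_irr.
  by rewrite (Phi_val a u) PhiK pE; case: ifP.
have Fa : (Fix G (ball v k `&` ball w k) : set (aut T)) (val a).
  exact/FixCP/subgP.
exists (val a : aut T).
  split=> // u /(semi_treeP u vw) lt; rewrite aP ifN // -leqNgt ltnW //.
(* Since [a] and [f] agree on the side of [v], this factor is trivial there. *)
exists ((val a : aut T)^-1 * f)%g; last by rewrite mulVKg.
split; first by apply: subgroupM => //; exact: subgroupV.
have wv : adj w v by rewrite adj_sym.
move=> u /(semi_treeP u wv) lt; change (sym_inv (val a : aut T) (f u) = u).
by rewrite -[RHS](sym_funK (val a : aut T)) aP lt.
Qed.

Theorem corollary6p4 (T : tree) (k : nat) (hk : (0 < k)%N)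
    (G : subgroup (aut T)) (hG : closed (subgroup_set G)) :
  property_IP k G <-> property_P k G.
Proof.
split=> [GP|]; [exact: IP_property_P hk GP hG|exact: P_property_IP hk].
Qed.
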